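(* Let $G(s)$ be a square real-rational transfer function matrix of the form $$G(s)=G_{0}(s)+\frac{1}{s}C_{1}+\frac{1}{s^{2}}C_{2}+sA_{1}+s^{2}A_{2}+G(\infty),$$ where $C_1,C_2,A_1,A_2,G(\infty)$ are constant real square matrices, $G_{0}(s)$ is a strictly proper real-rational matrix, and $G_{0}(s)$ has no poles at zero and infinity. Then $G(s)$ is lossless negative imaginary if and only if $G_{0}(s)$ is lossless negative imaginary, $A_{2}=A_{2}^{*}\le 0$, $C_{2}=C_{2}^{*}\ge 0$, $A_{1}+A_{1}^{*}=0$, $C_{1}+C_{1}^{*}=0$ and $G(\infty)=G^{T}(\infty)$.
   Context: $A^{T}$ and $A^{*}$ denote the transpose and complex conjugate transpose of a matrix; $\ge 0$ ($\le 0$) means positive (negative) semidefinite. The symbol $G(\infty)$ denotes the constant matrix term in the displayed decomposition (it is the value of $G$ at infinity when $G$ is proper). A square real-rational transfer function matrix $G(s)$ (a square matrix of rational functions with real coefficients) is negative imaginary if: (1) $G(s)$ has no poles in $\mathrm{Re}[s]>0$; (2) $j[G(j\omega)-G^{*}(j\omega)]\ge 0$ for all $\omega>0$ except values of $\omega$ where $j\omega$ is a pole of $G(s)$; (3) if $s=0$ is a pole of $G(s)$, then it is at most a double pole, $\lim_{s\to 0}s^{2}G(s)$ is positive semidefinite Hermitian, and $\lim_{s\to 0}s^{m}G(s)=0$ for all $m\ge 3$; (4) if $s=j\omega_0$ with $\omega_0>0$ finite is a pole of $G(s)$, it is at most a simple pole and $K=\lim_{s\to j\omega_0}(s-j\omega_0)jG(s)$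 is positive semidefinite Hermitian; (5) if $s=j\infty$ is a pole of $G(s)$, then it is at most a double pole, $\lim_{\omega\to\infty}G(j\omega)/(j\omega)^2$ is negative semidefinite Hermitian, and $\lim_{\omega\to\infty}G(j\omega)/(j\omega)^m=0$ for all $m\ge 3$. A square real-rational $G(s)$ is lossless negative imaginary if it is negative imaginary and $j[G(j\omega)-G^{*}(j\omega)]=0$ for all $\omega>0$ except values of $\omega$ where $j\omega$ is a pole of $G(s)$. *)

(* Defs.v *)
From HB Require Import structures.
From mathcomp Require Import all_boot all_order all_algebra.
From mathcomp Require Import all_classical all_reals all_analysis.
From mathcomp Require Import complex.

Set Implicit Arguments.
Unset Strict Implicit.
Unset Printing Implicit Defensive.

Import Order.TTheory GRing.Theory Num.Theory.
Import numFieldNormedType.Exports.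

Local Open Scope classical_set_scope.
Local Open Scope ring_scope.
Local Open Scope complex_scope.
Local Open Scope sesquilinear_scope.

(* The norm topology of R[i], which the library provides for abstract
   numeric fields and for the regular algebra R[i]^o only. *)
#[warnings="-redundant-canonical-projection"]
HB.instance Definition _ (R : rcfType) := PseudoPointedMetric.copy R[i] R[i]^o.

Section RationalFunctions.
Variable R : realType.
Implicit Types (r : {fraction {poly R}}) (z : R[i]).

(* A fraction is an equivalence class of pairs of polynomials, and its chosen
   representative need not be in lowest terms; dividing by the gcd cancels the
   removable singularities. *)
Definition numer r : {poly R} :=
  (frac (repr r)).1 %/ gcdp (frac (repr r)).1 (frac (repr r)).2.
Definition denom r : {poly R} :=
  (frac (repr r)).2 %/ gcdp (frac (repr r)).1 (frac (repr r)).2.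

(* Meaningful only when z is not a pole of r; equal to 0 at the poles. *)
Definition reval r z : R[i] :=
  (map_poly (real_complex R) (numer r)).[z] /
  (map_poly (real_complex R) (denom r)).[z].

(* The order is 0 at a point which is not a pole. *)
Definition rpole_order r z : nat := mup z (map_poly (real_complex R) (denom r)).

(* deg (numer r) - deg (denom r), truncated at 0. *)
Definition rpole_order_infty r : nat := (size (numer r) - size (denom r))%N.

Definition rstrictly_proper r : bool := (size (numer r) < size (denom r))%N.

Definition rvar : {fraction {poly R}} := tofrac 'X.

Definition rconst (a : R) : {fraction {poly R}} := tofrac a%:P.

End RationalFunctions.
Arguments rvar {R}.

Section TransferFunctions.
Variables (R : realType) (n : nat).
Implicit Types (G : 'M[{fraction {poly R}}]_n) (z : R[i]).

Definition meval G z : 'M[R[i]]_n := \matrix_(i, j) reval (G i j) z.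

(* The order of a pole of a matrix is the largest order among its entries. *)
Definition pole_order G z : nat := \max_i \max_j rpole_order (G i j) z.
Definition pole_order_infty G : nat :=
  \max_i \max_j rpole_order_infty (G i j).

Definition is_pole G z : bool := (0 < pole_order G z)%N.
Definition is_pole_infty G : bool := (0 < pole_order_infty G)%N.

Definition strictly_proper G : Prop := forall i j, rstrictly_proper (G i j).

Definition psdmx (M : 'M[R[i]]_n) : Prop :=
  M \is hermsymmx /\ forall x : 'cV[R[i]]_n, 0 <= (x ^t* *m M *m x) 0 0.
Definition nsdmx (M : 'M[R[i]]_n) : Prop :=
  M \is hermsymmx /\ forall x : 'cV[R[i]]_n, (x ^t* *m M *m x) 0 0 <= 0.

Definition jaxis (w : R) : R[i] := 'i * w%:C.

Definition jdiff G (w : R) : 'M[R[i]]_n :=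
  'i *: (meval G (jaxis w) - (meval G (jaxis w)) ^t* ).

Record negative_imaginary G : Prop := NegativeImaginary {
  ni_stable : forall z, 0 < complex.Re z -> ~~ is_pole G z ;
  ni_axis : forall w : R, 0 < w -> ~~ is_pole G (jaxis w) ->
    psdmx (jdiff G w) ;
  ni_pole0 : is_pole G 0 ->
    [/\ (pole_order G 0%R <= 2)%N,
        exists2 K : 'M[R[i]]_n,
          z ^+ 2 *: meval G z @[z --> (0 : R[i])^'] --> K & psdmx K
      & forall m : nat, (3 <= m)%N ->
          z ^+ m *: meval G z @[z --> (0 : R[i])^'] --> (0 : 'M[R[i]]_n)] ;
  ni_pole_axis : forall w0 : R, 0 < w0 -> is_pole G (jaxis w0) ->
    (pole_order G (jaxis w0) <= 1)%N /\
    exists2 K : 'M[R[i]]_n,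
      (z - jaxis w0) *: ('i *: meval G z) @[z --> (jaxis w0)^'] --> K
      & psdmx K ;
  ni_pole_infty : is_pole_infty G ->
    [/\ (pole_order_infty G <= 2)%N,
        exists2 K : 'M[R[i]]_n,
          (jaxis w ^+ 2)^-1 *: meval G (jaxis w) @[w --> +oo%R] --> K & nsdmx K
      & forall m : nat, (3 <= m)%N ->
          (jaxis w ^+ m)^-1 *: meval G (jaxis w) @[w --> +oo%R]
            --> (0 : 'M[R[i]]_n)]
}.

Definition lossless_negative_imaginary G : Prop :=
  negative_imaginary G /\
  forall w : R, 0 < w -> ~~ is_pole G (jaxis w) -> jdiff G w = 0.

End TransferFunctions.

Definition ratmx (R : realType) (n : nat) (A : 'M[R]_n)
  : 'M[{fraction {poly R}}]_n := map_mx (@rconst R) A.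

Definition complexmx (R : realType) (n : nat) (A : 'M[R]_n) : 'M[R[i]]_n :=
  map_mx (real_complex R) A.

(* Main.v *)
(* Write u = jw.  Since G is real, G(u)^* is G(-u)^T, so for w > 0 the entries of
   G(u) - G(u)^* are those of G0(u) - G0(u)^* plus a Laurent polynomial in u with
   coefficients C1 + C1^T, C2 - C2^T, A1 + A1^T, A2 - A2^T and Ginf - Ginf^T.  The G0
   part has a limit as w -> 0+ and tends to 0 as w -> +oo, so if the sum vanishes then
   the coefficients vanish one after the other: those of u^-2 and u^-1 at 0, the
   other three at infinity.  Away from 0 the matrices G and G0 have the same poles
   and the same residues, while C2 and A2 are the limits of s^2 G(s) at 0 and of
   G(jw) / (jw)^2 at infinity. *)
Require Import Defs.
From HB Require Import structures.
From mathcomp Require Import all_boot all_order all_algebra.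
From mathcomp Require Import all_classical all_reals all_analysis.
From mathcomp Require Import complex ring zify.
Import Order.TTheory GRing.Theory Num.Theory.
Local Open Scope ring_scope.
Local Open Scope complex_scope.
Local Open Scope sesquilinear_scope.

Set Implicit Arguments.
Unset Strict Implicit.
Unset Printing Implicit Defensive.

(** * Laurent polynomials over a field, and the chosen representatives of fractions *)

Definition laurent (K : fieldType) (c1 c2 a1 a2 b u : K) : K :=
  u^-1 * c1 + (u ^+ 2)^-1 * c2 + u * a1 + u ^+ 2 * a2 + b.

(** Inversion exchanges the roles of 0 and infinity, so behaviour at infinity is studied as
    behaviour at 0 with the [c] and [a] coefficients swapped. *)
Lemma laurentV (K : fieldType) (c1 c2 a1 a2 b u : K) :
  laurent c1 c2 a1 a2 b u^-1 = laurent a1 a2 c1 c2 b u.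
Proof.
rewrite /laurent !exprVn !invrK; ring.
Qed.

Lemma laurentN (K : fieldType) (c1 c2 a1 a2 b u : K) :
  laurent (- c1) (- c2) (- a1) (- a2) (- b) u = - laurent c1 c2 a1 a2 b u.
Proof. by rewrite /laurent !mulrN -!opprD. Qed.

(** Used twice: in the fraction field, to write the sum as a quotient of polynomials, and in [R[i]],
    to evaluate that quotient. *)
Lemma add_laurentE (F : fieldType) (x p q c1 c2 a1 a2 b : F) :
  x != 0 -> q != 0 ->
  p / q + laurent c1 c2 a1 a2 b x =
  (x ^+ 2 * p + q * (x * c1 + c2 + x ^+ 3 * a1 + x ^+ 4 * a2 + x ^+ 2 * b))
    / (x ^+ 2 * q).
Proof. by move=> x0 q0; rewrite /laurent; field; rewrite x0 q0. Qed.

Lemma rmorph_laurent (K K' : fieldType) (f : {rmorphism K -> K'})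
    (c1 c2 a1 a2 b u : K) :
  f (laurent c1 c2 a1 a2 b u) = laurent (f c1) (f c2) (f a1) (f a2) (f b) (f u).
Proof. by rewrite /laurent !(rmorphD, rmorphM, fmorphV, rmorphXn). Qed.

(** The product in the quotient is the class of the product of pairs, so the claim becomes a
    cross-multiplication identity for [repr a]. *)
Lemma mulr_denom_repr (A : idomainType) (a : {fraction A}) :
  a * tofrac (frac (repr a)).2 = tofrac (frac (repr a)).1.
Proof.
rewrite -{1}[a]generic_quotient.reprK; unlock FracField.tofrac.
rewrite -[LHS]FracField.pi_mul; apply/generic_quotient.eqmodP => /=.
rewrite FracField.equivfE /FracField.mulf !(numer_Ratio, denom_Ratio).
  by rewrite !mulr1 mulrC.
all: by rewrite ?mulf_neq0 ?denom_ratioP ?oner_neq0.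
Qed.

Lemma eq_frac_div (A : idomainType) (a : {fraction A}) (x y : A) : y != 0 ->
  (a == tofrac x / tofrac y) = (a * tofrac y == tofrac x).
Proof.
move=> y0; have ty0 : tofrac y != 0 by rewrite tofrac_eq0.
by rewrite -(inj_eq (mulIf ty0)) mulfVK.
Qed.

Lemma frac_div_eq (A : idomainType) (x y x' y' : A) : y != 0 -> y' != 0 ->
  tofrac x / tofrac y = tofrac x' / tofrac y' -> x * y' = x' * y.
Proof.
move=> y0 y'0 /eqP; rewrite eqr_div ?tofrac_eq0 // -!tofracM tofrac_eq.
by move=> /eqP.
Qed.

Local Notation "p ^%:C" := (map_poly (real_complex _) p)
  (at level 2, format "p ^%:C").

(** * Rational functions *)

Section Fractions.
Variable R : realType.
Implicit Types (r g : {fraction {poly R}}) (p q : {poly R}) (z : R[i]).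

Lemma denom_neq0 r : denom r != 0.
Proof.
have d0 : (frac (repr r)).2 != 0 by exact: denom_ratioP.
by rewrite /denom divp_eq0 !negb_or d0 -leqNgt leq_gcdpr // gcdp_eq0 negb_and d0 orbT.
Qed.

Lemma coprime_numer_denom r : coprimep (numer r) (denom r).
Proof.
by apply: coprimep_div_gcd; rewrite denom_ratioP orbT.
Qed.

Lemma numer_div_denom r : r = tofrac (numer r) / tofrac (denom r).
Proof.
have d0 : (frac (repr r)).2 != 0 by exact: denom_ratioP.
set x := repr r in d0 *.
have gn : numer r * gcdp (frac x).1 (frac x).2 = (frac x).1 by rewrite divpK ?dvdp_gcdl.
have gd : denom r * gcdp (frac x).1 (frac x).2 = (frac x).2 by rewrite divpK ?dvdp_gcdr.
have := mulr_denom_repr r; rewrite -/x.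
rewrite -{1}gn -{1}gd !tofracM mulrA => r_eq; apply/eqP.
rewrite eq_frac_div ?denom_neq0 //; apply/eqP; apply: mulIf r_eq.
by rewrite tofrac_eq0 gcdp_eq0 negb_and d0 orbT.
Qed.

(** By Gauss, the reduced denominator divides [q] because it is coprime to the reduced numerator.
    Evaluation and pole orders can thus be read off any fraction, up to the common factor [c]. *)
Lemma reduced_fraction r p q : q != 0 -> r = tofrac p / tofrac q ->
  exists2 c, c != 0 & p = c * numer r /\ q = c * denom r.
Proof.
move=> q0 r_eq; have d0 := denom_neq0 r.
have cross : p * denom r = numer r * q.
  by apply: (frac_div_eq q0 d0); rewrite -r_eq -numer_div_denom.
have : denom r %| q.
  rewrite -(Gauss_dvdpr q (q := numer r)) -?cross ?dvdp_mull //.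
  by rewrite coprimep_sym coprime_numer_denom.
move=> /dvdpP[c q_eq]; exists c; first by apply: contraNneq q0 => c0; rewrite q_eq c0 mul0r.
by split=> //; apply: (mulIf d0); rewrite cross q_eq mulrCA mulrA.
Qed.

(** The common factor divides [q], so it does not vanish at [z] either and cancels. *)
Lemma reval_div r p q z : r = tofrac p / tofrac q -> (q^%:C).[z] != 0 ->
  reval r z = (p^%:C).[z] / (q^%:C).[z].
Proof.
move=> r_eq qz; have q0 : q != 0 by apply: contraNneq qz => ->; rewrite rmorph0 horner0.
have [c _ [-> q_eq]] := reduced_fraction q0 r_eq.
move: qz; rewrite q_eq !rmorphM !hornerM mulf_eq0 negb_or => /andP[cz _].
by rewrite -mulf_div divff // mul1r.
Qed.

(** A common factor can only add to the multiplicity of [z] in the denominator. *)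
Lemma rpole_order_leq r p q z : q != 0 -> r = tofrac p / tofrac q ->
  (rpole_order r z <= mup z (q^%:C))%N.
Proof.
move=> q0 r_eq; have [c c0 [_ ->]] := reduced_fraction q0 r_eq.
by rewrite rmorphM mupM ?map_poly_eq0 ?denom_neq0 // leq_addl.
Qed.

Lemma rpole_order_infty_leq r p q : q != 0 -> r = tofrac p / tofrac q ->
  (rpole_order_infty r <= size p - size q)%N.
Proof.
move=> q0 r_eq; have [c c0 [-> ->]] := reduced_fraction q0 r_eq.
have [n0|n0] := eqVneq (numer r) 0; first by rewrite /rpole_order_infty n0 size_poly0.
rewrite !size_mul ?denom_neq0 //; move: (c0) (n0) (denom_neq0 r); rewrite -!size_poly_gt0.
rewrite /rpole_order_infty.
(* All three sizes are positive, so the predecessors coming from the size of a product are harmless,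
   and [size c] drops out of the difference. *)
move: (size c) (size (numer r)) (size (denom r)) => [|x] [|y] [|w] // _ _ _.
by rewrite !addSn !addnS /=; lia.
Qed.

Lemma rpole_order_eq0 r z : (rpole_order r z == 0)%N = (((denom r)^%:C).[z] != 0).
Proof.
have d0 : (denom r)^%:C != 0 by rewrite map_poly_eq0 denom_neq0.
by rewrite -leqn0 mup_leq // expr1 dvdp_XsubCl.
Qed.

Definition rlaurent (c1 c2 a1 a2 b : R) : {fraction {poly R}} :=
  laurent (rconst c1) (rconst c2) (rconst a1) (rconst a2) (rconst b) rvar.

(** * A scalar rational function plus a Laurent polynomial *)

Section AddLaurent.
Variables (g0 : {fraction {poly R}}) (c1 c2 a1 a2 b : R).

(** This is ['X^2] times the Laurent polynomial. The fraction [P / Q] below need not be reduced,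
    which is why the pole orders are first bounded from above only. *)
Definition laurent_numer : {poly R} :=
  'X * c1%:P + c2%:P + 'X^3 * a1%:P + 'X^4 * a2%:P + 'X^2 * b%:P.

Let P := 'X^2 * numer g0 + denom g0 * laurent_numer.
Let Q := 'X^2 * denom g0.
Let g := g0 + rlaurent c1 c2 a1 a2 b.

Let Q0 : Q != 0.
Proof. by rewrite mulf_neq0 ?denom_neq0 // -size_poly_eq0 size_polyXn. Qed.

Let g_eq : g = tofrac P / tofrac Q.
Proof.
rewrite /g {1}(numer_div_denom g0) /rlaurent.
rewrite add_laurentE ?tofrac_eq0 ?polyX_eq0 ?denom_neq0 //.
by rewrite /P /Q /laurent_numer !(tofracD, tofracM, tofracXn).
Qed.

(** The extra factor ['X^2] of the denominator has no zero at [z]. *)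
Lemma rpole_order_add_laurent_leq z : z != 0 -> (rpole_order g z <= rpole_order g0 z)%N.
Proof.
move=> z0; apply: leq_trans (rpole_order_leq z Q0 g_eq) _.
by rewrite rmorphM /= map_polyXn mupMr // rootE hornerXn expf_eq0 /=.
Qed.

Lemma rpole_order_add_laurent_at0 : rpole_order g0 0 = 0%N -> (rpole_order g 0%R <= 2)%N.
Proof.
move=> g00; apply: leq_trans (rpole_order_leq 0 Q0 g_eq) _.
rewrite rmorphM /= map_polyXn mupM ?map_poly_eq0 ?denom_neq0 -?size_poly_eq0 ?size_polyXn //.
(* Only ['X^2] contributes to the multiplicity at 0; ['X] is read as ['X - 0]. *)
by rewrite [mup _ (denom _)^%:C]g00 addn0 -['X]subr0 -polyC0 mup_XsubCX eqxx.
Qed.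

Lemma rpole_order_infty_add_laurent : rstrictly_proper g0 -> (rpole_order_infty g <= 2)%N.
Proof.
move=> g0p; apply: leq_trans (rpole_order_infty_leq Q0 g_eq) _.
have szX k (a : R) : (size ('X^k * a%:P)%R <= k.+1)%N.
  by rewrite mulrC mul_polyC (leq_trans (size_scale_leq _ _)) // size_polyXn.
have szD k p q : (size p <= k)%N -> (size q <= k)%N -> (size (p + q)%R <= k)%N.
  by move=> pk qk; rewrite (leq_trans (size_polyD _ _)) // geq_max pk.
have szL : (size laurent_numer <= 5)%N.
  do !apply: (szD).
  - exact: leq_trans (szX 1%N _) _.
  - exact: leq_trans (size_polyC_leq1 _) _.
  - exact: leq_trans (szX 3%N _) _.
  - exact: leq_trans (szX 4%N _) _.
  - exact: leq_trans (szX 2%N _) _.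
have d0 : (0 < size (denom g0))%N by rewrite size_poly_gt0 denom_neq0.
have szQ : size Q = (size (denom g0)).+2 by rewrite /Q mulrC size_mulXn ?denom_neq0.
(* Both summands of [P] have size at most [size (denom g0) + 4]: the first by strict properness, the
   second because [laurent_numer] has degree at most 4. *)
rewrite leq_subLR szQ; apply: szD.
  have [->|n0] := eqVneq (numer g0) 0; first by rewrite mulr0 size_poly0.
  rewrite mulrC size_mulXn //; move: g0p; rewrite /rstrictly_proper.
  by move: (size _) (size _) => x y; lia.
apply: leq_trans (size_polyMleq _ _) _.
move: szL; clear -d0; move: (size _) d0 (size _) => [//|x] _ y y5.
by rewrite addSn /= addnC addn2 -[x.+3.+2]addn4; lia.
Qed.

Lemma reval_add_laurent z : z != 0 -> ((denom g0)^%:C).[z] != 0 ->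
  reval g z = reval g0 z + laurent c1%:C c2%:C a1%:C a2%:C b%:C z.
Proof.
move=> z0 dz; rewrite (reval_div g_eq) /P /Q /laurent_numer.
  rewrite /reval add_laurentE // !(rmorphXn, rmorphD, rmorphM) /= !map_polyX !map_polyC /=.
  by rewrite !(hornerD, hornerM, hornerC, horner_exp, hornerX).
by rewrite rmorphM /= map_polyXn hornerM hornerXn mulf_neq0 // expf_neq0.
Qed.

End AddLaurent.

End Fractions.

Import numFieldNormedType.Exports.
Local Open Scope classical_set_scope.

(** * Limits *)

Section Limits.
Variable K : numFieldType.
Implicit Types (p q : {poly K}).

Lemma limit_unique (T : Type) (F : set_system T) {FF : ProperFilter F}
  (f : T -> K) (a b : K) :
  f z @[z --> F] --> a -> f z @[z --> F] --> b -> a = b.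
Proof. exact: (cvg_unique (@norm_hausdorff _ _)). Qed.

(** The form of most limit computations below: a known limit, its value simplified, and an eventual
    equality of functions. *)
Lemma cvg_near_eq (T : Type) (F : set_system T) {FF : Filter F}
    (f g : T -> K) (a b : K) :
  f z @[z --> F] --> a -> a = b -> (\forall z \near F, f z = g z) ->
  g z @[z --> F] --> b.
Proof. by move=> fa <- fg; apply: cvg_trans fa; exact: near_eq_cvg. Qed.

(** An entourage of matrices controls all entries at once; there are finitely many of them, so the
    entrywise events of the filter can be intersected. *)
Lemma cvg_mxP (T : Type) (F : set_system T) {FF : Filter F} n
    (f : T -> 'M[K]_n) (M : 'M[K]_n) :
  f z @[z --> F] --> M <-> forall i j, f z i j @[z --> F] --> M i j.
Proof.
split=> [fM i j|fM].
  exact: (@cvg_comp _ _ _ f (fun N : 'M[K]_n => N i j) _ _ _ fM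
            (@coord_continuous K n n i j M)).
apply/cvg_mx_entourageP => A entA.
have near_entry i j : \forall N \near (f z @[z --> F]), (M i j, (N : 'M[K]_n) i j) \in A.
  have /cvg_entourageP/(_ _ entA) := fM i j.
  rewrite !near_simpl; apply: filterS => z; exact: mem_set.
have := @filter_forall _ _ (fun i (N : 'M[K]_n) => forall j, (M i j, N i j) \in A)
          _ _ (fun i => @filter_forall _ _ _ _ _ (near_entry i)).
exact.
Qed.

Lemma limit_mx_unique (T : Type) (F : set_system T) {FF : ProperFilter F} n
    (f : T -> 'M[K]_n) (M N : 'M[K]_n) :
  f z @[z --> F] --> M -> f z @[z --> F] --> N -> M = N.
Proof.
move=> /cvg_mxP fM /cvg_mxP fN; apply/matrixP => i j.
exact: limit_unique (fM i j) (fN i j).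
Qed.

Lemma cvg_horner p (T : Type) (F : set_system T) {FF : Filter F}
    (u : T -> K) (a : K) :
  u z @[z --> F] --> a -> p.[u z] @[z --> F] --> p.[a].
Proof.
move=> ua; elim/poly_ind: p => [|p c IHp].
  rewrite horner0 [X in X @ _](_ : _ = cst 0); first exact: cvg_cst.
  by apply/funext => z; rewrite horner0.
rewrite hornerMXaddC [X in X @ _](_ : _ = fun z => p.[u z] * u z + c).
  by apply: cvgD; [exact: cvgM | exact: cvg_cst].
by apply/funext => z; rewrite hornerMXaddC.
Qed.

Arguments cvg_horner p {T F FF u a} _ [t].

Lemma near_neq (T : Type) (F : set_system T) {FF : Filter F}
    (u : T -> K) (a : K) :
  u z @[z --> F] --> a -> a != 0 -> \forall z \near F, u z != 0.
Proof. by move=> ua a0; exact: (cvgr_neq0 _ ua a0). Qed.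

Lemma cvg_ratfun p q (T : Type) (F : set_system T) {FF : Filter F}
    (u : T -> K) (a : K) :
  u z @[z --> F] --> a -> q.[a] != 0 ->
  p.[u z] / q.[u z] @[z --> F] --> p.[a] / q.[a].
Proof. by move=> ua qa; apply: cvgM; [|apply: cvgV => //]; exact: cvg_horner. Qed.

Arguments cvg_ratfun p q {T F FF u a} _ _ [t].

(** Write [p] as a power of ['X - a] times [q] with [q.[a] != 0]; near [a] and off [a], both factors
    are nonzero. *)
Lemma dnbhs_horner_neq0 p (a : K) : p != 0 -> \forall z \near a^', p.[z] != 0.
Proof.
move=> p0; have [m [q /implyP/(_ p0) qa p_eq]] := multiplicity_XsubC p a.
have near_q : \forall z \near a^', q.[z] != 0.
  by apply: (near_neq (a := q.[a])) => //; apply: cvg_horner; exact: cvg_within.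
near=> z; rewrite p_eq hornerM horner_exp !hornerE mulf_neq0 //.
  by near: z.
by rewrite expf_neq0 // subr_eq0; near: z; exact: nbhs_dnbhs_neq.
Unshelve. all: by end_near. Qed.

(* The polynomial u^k p(1/u) in u, which turns limits at infinity into limits at 0. *)
Lemma horner_inv_rev k p (u : K) : (size p <= k.+1)%N -> u != 0 ->
  (\poly_(j < k.+1) p`_(k - j)).[u] = u ^+ k * p.[u^-1].
Proof.
move=> pk u0; rewrite horner_poly (horner_coef_wide _ pk) mulr_sumr.
rewrite (reindex_inj rev_ord_inj) /=; apply: eq_bigr => i _.
have ik : (i <= k)%N by rewrite -ltnS.
rewrite subSS subKn // mulrCA; congr (_ * _).
by rewrite exprVn -expfB_cond ?(negPf u0).
Qed.

(* Unlike hornerE, this does not reassociate sums. *)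
Let hornerS := (@hornerD K, @hornerM K, @hornerN K, @hornerC K, @hornerX K, @hornerXn K).

(** * Limits along a nonvanishing [u] tending to 0, such as z, jw or 1/(jw) *)

Section AtZero.
Variables (T : Type) (F : set_system T) (u : T -> K).
Context {FF : ProperFilter F}.
Hypothesis u_cvg0 : u z @[z --> F] --> (0 : K).
Hypothesis u_neq0 : \forall z \near F, u z != 0.

Lemma cvg_horner_inv k p : (size p <= k.+1)%N ->
  u z ^+ k * p.[(u z)^-1] @[z --> F] --> p`_k.
Proof.
move=> pk; apply: (cvg_near_eq (cvg_horner (\poly_(j < k.+1) p`_(k - j)) u_cvg0)).
  by rewrite horner_coef0 coef_poly subn0.
by near=> z; rewrite -horner_inv_rev //; near: z.
Unshelve. all: by end_near. Qed.

Lemma near_horner_inv_neq0 p : p != 0 -> \forall z \near F, p.[(u z)^-1] != 0.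
Proof.
move=> p0; have szp : (size p <= (size p).-1.+1)%N by rewrite prednK ?size_poly_gt0.
have : \forall z \near F, u z ^+ (size p).-1 * p.[(u z)^-1] != 0.
  by apply: (near_neq (cvg_horner_inv szp)); rewrite -lead_coefE lead_coef_eq0.
by apply: filterS => z; apply: contraNneq => ->; rewrite mulr0.
Qed.

(** Multiply numerator and denominator by [u] to the degree of [q], then apply [cvg_horner_inv] to
    each. *)
Lemma cvg_ratfun_inv p q : q != 0 -> (size p <= size q)%N ->
  p.[(u z)^-1] / q.[(u z)^-1] @[z --> F] --> p`_(size q).-1 / lead_coef q.
Proof.
move=> q0 pq; have szq : size q = (size q).-1.+1 by rewrite prednK ?size_poly_gt0.
have cp : (size p <= (size q).-1.+1)%N by rewrite -szq.
have cq : (size q <= (size q).-1.+1)%N by rewrite -szq.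
have lc0 : q`_(size q).-1 != 0 by rewrite -lead_coefE lead_coef_eq0.
apply: (cvg_near_eq (cvgM (cvg_horner_inv cp) (cvgV lc0 (cvg_horner_inv cq)))) => //.
near=> z; rewrite /= -mulf_div divff ?mul1r // expf_neq0 //; near: z; exact: u_neq0.
Unshelve. all: by end_near. Qed.

Variables (d : T -> K) (l : K).
Hypothesis d_cvg : d z @[z --> F] --> l.

Lemma cvg_exprn_at0 k : (0 < k)%N -> u z ^+ k @[z --> F] --> (0 : K).
Proof.
move=> k0; apply: (cvg_near_eq (cvg_horner 'X^k u_cvg0)).
  by rewrite hornerXn expr0n eqn0Ngt k0.
by near=> z; rewrite hornerXn.
Unshelve. all: by end_near. Qed.

Lemma cvg_sqr_mul0 : u z ^+ 2 * d z @[z --> F] --> (0 : K).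
Proof.
apply: (cvg_near_eq (cvgM (@cvg_exprn_at0 2 isT) d_cvg)); first by rewrite mul0r.
exact: nearW.
Qed.

(** Multiplied by the square of [u], the Laurent part becomes a polynomial with constant coefficient
    [c2], and the convergent [d] disappears. *)
Lemma cvg_laurent_mul2 (c1 c2 a1 a2 b : K) :
  u z ^+ 2 * (d z + laurent c1 c2 a1 a2 b (u z)) @[z --> F] --> c2.
Proof.
apply: (cvg_near_eq (cvgD (cvgM (@cvg_exprn_at0 2 isT) d_cvg)
  (cvg_horner ('X * c1%:P + c2%:P + 'X^3 * a1%:P + 'X^4 * a2%:P + 'X^2 * b%:P) u_cvg0))).
  by rewrite !hornerS /= ?expr0n /= !(mul0r, addr0, add0r).
near=> z; rewrite /= !hornerS /laurent mulrDr; congr (_ + _).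
have uz : u z != 0 by near: z.
by field.
Unshelve. all: by end_near. Qed.

Arguments cvg_laurent_mul2 c1 c2 a1 a2 b [t].

Lemma cvg_laurent_mul (m : nat) (c1 c2 a1 a2 b : K) : (3 <= m)%N ->
  u z ^+ m * (d z + laurent c1 c2 a1 a2 b (u z)) @[z --> F] --> (0 : K).
Proof.
move=> m3; have m20 : (0 < m - 2)%N by rewrite subn_gt0.
apply: (cvg_near_eq (cvgM (cvg_exprn_at0 m20) (cvg_laurent_mul2 c1 c2 a1 a2 b))).
  by rewrite mul0r.
by near=> z; rewrite /= mulrA -exprD subnK // ltnW.
Unshelve. all: by end_near. Qed.

Arguments cvg_laurent_mul m c1 c2 a1 a2 b _ [t].

(** Multiply by [u ^+ k] for k = 2, 1, 0 in turn and take limits; each step uses the coefficients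
    already known to vanish. The terms in [a1] and [a2] die with [u]. *)
Lemma laurent_coef_eq0 (c1 c2 a1 a2 b : K) :
  (\forall z \near F, d z + laurent c1 c2 a1 a2 b (u z) = 0) ->
  [/\ c1 = 0, c2 = 0 & l + b = 0].
Proof.
move=> e0.
have mul0 k : u z ^+ k * (d z + laurent c1 c2 a1 a2 b (u z)) @[z --> F] --> (0 : K).
  apply: (cvg_near_eq (cvg_cst (0 : K))) => //; near=> z.
  by rewrite [_ + _](_ : _ = 0) ?mulr0 //; near: z.
have c2_0 : c2 = 0 by exact: limit_unique (cvg_laurent_mul2 c1 c2 a1 a2 b) (mul0 2%N).
have c1_0 : c1 = 0.
  apply: limit_unique (mul0 1%N).
  apply: (cvg_near_eq (cvgD (cvgM u_cvg0 d_cvg)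
    (cvg_horner (c1%:P + 'X^2 * a1%:P + 'X^3 * a2%:P + 'X * b%:P) u_cvg0))).
    by rewrite !hornerS /= ?expr0n /= !(mul0r, addr0, add0r).
  near=> z; rewrite /= !hornerS c2_0 /laurent mulrDr; congr (_ + _).
  have uz : u z != 0 by near: z.
  by field.
split=> //; apply: limit_unique (mul0 0%N).
apply: (cvg_near_eq (cvgD d_cvg
  (cvg_horner ('X * a1%:P + 'X^2 * a2%:P + b%:P) u_cvg0))).
  by rewrite !hornerS /= ?expr0n /= !(mul0r, addr0, add0r).
near=> z; rewrite /= !hornerS expr0 mul1r /laurent c1_0 c2_0.
by rewrite !mulr0 !add0r.
Unshelve. all: by end_near. Qed.

End AtZero.

(** Off 0 the Laurent part is a quotient with denominator ['X^2] nonzero at [a], so it stays bounded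
    near [a] and the factor [z - a] kills it. *)
Lemma cvg_residue_laurent (c1 c2 a1 a2 b a e k : K) (f0 f : K -> K) : a != 0 ->
  (\forall z \near a^', f z = f0 z + laurent c1 c2 a1 a2 b z) ->
  (z - a) * (e * f0 z) @[z --> a^'] --> k ->
  (z - a) * (e * f z) @[z --> a^'] --> k.
Proof.
move=> a0 ff0 f0k; have id_cvg : z @[z --> a^'] --> a by exact: cvg_within.
have X2a : ('X^2).[a] != 0 by rewrite hornerXn expf_neq0.
apply: (cvg_near_eq (cvgD f0k (cvgM (cvg_horner ('X - a%:P) id_cvg)
  (cvg_ratfun (e%:P * ('X * c1%:P + c2%:P + 'X^3 * a1%:P + 'X^4 * a2%:P + 'X^2 * b%:P))
     'X^2 id_cvg X2a)))).
  by rewrite !hornerS subrr mul0r addr0.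
near=> z => /=.
rewrite [f z](_ : _ = f0 z + laurent c1 c2 a1 a2 b z); last by near: z.
have z0 : z != 0 by near: z; exact: (near_neq id_cvg).
by rewrite !hornerS /laurent; field.
Unshelve. all: by end_near. Qed.

End Limits.

(** * Conjugation, the imaginary axis, and limits of rational functions *)

Section ComplexLimits.
Variable R : realType.
Implicit Types (r : {fraction {poly R}}).

Lemma conj_real (x : R) : Num.conj (x%:C : R[i]) = x%:C.
Proof. by rewrite -[Num.conj _]/(conjc x%:C) /conjc /= oppr0. Qed.

Lemma conj_jaxis (w : R) : Num.conj (jaxis w) = - jaxis w.
Proof. by apply/eqP; rewrite eq_complex /=; apply/andP; split; apply/eqP; ring. Qed.

Lemma norm_jaxis (w : R) : `|jaxis w| = `|w|%:C.
Proof.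
by rewrite normc_def /= !mul0r !mul1r subr0 add0r expr0n /= add0r sqrtr_sqr.
Qed.

Lemma jaxis_eq0 (w : R) : (jaxis w == 0) = (w == 0).
Proof.
rewrite -normr_eq0 norm_jaxis -(rmorph0 (real_complex R)).
by rewrite (inj_eq (fmorph_inj _)) normr_eq0.
Qed.

Lemma cvg_conj (K : numClosedFieldType) (T : Type) (F : set_system T)
    {FF : Filter F} (f : T -> K) (a : K) :
  f z @[z --> F] --> a -> Num.conj (f z) @[z --> F] --> Num.conj a.
Proof.
move=> /cvgrPdist_lt fa; apply/cvgrPdist_lt => e e0.
by apply: filterS (fa e e0) => z; rewrite -rmorphB norm_conjC.
Qed.

Lemma cvg_sub_conj (K : numClosedFieldType) (T : Type) (F : set_system T)
    {FF : Filter F} (f g : T -> K) (a b : K) :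
  f z @[z --> F] --> a -> g z @[z --> F] --> b ->
  f z - Num.conj (g z) @[z --> F] --> a - Num.conj b.
Proof. by move=> fa gb; apply: cvgB => //; exact: cvg_conj. Qed.

Lemma cvg_to0_norm (K : numFieldType) (T : Type) (F : set_system T)
    {FF : Filter F} (f : T -> K) :
  (forall e, 0 < e -> \forall z \near F, `|f z| < e) -> f z @[z --> F] --> (0 : K).
Proof.
move=> fe; apply/cvgrPdist_lt => e e0.
by apply: filterS (fe e e0) => z; rewrite sub0r normrN.
Qed.

Lemma cvg_jaxis_right0 : jaxis w @[w --> (0 : R)^'+] --> (0 : R[i]).
Proof.
(* A positive [e] in [R[i]] has zero imaginary part and positive real part, so the estimate reduces
   to one in [R]. *)
apply: (@cvg_to0_norm R[i]) => e; rewrite ltcE /= => /andP[/eqP ei er].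
near=> w; rewrite norm_jaxis ltcE /= ei eqxx /= gtr0_norm; near: w.
  exact: nbhs_right_lt.
exact: nbhs_right_gt.
Unshelve. all: by end_near. Qed.

Lemma cvg_jaxisV_pinfty : (jaxis w)^-1 @[w --> +oo] --> (0 : R[i]).
Proof.
apply: (@cvg_to0_norm R[i]) => e; rewrite ltcE /= => /andP[/eqP ei er].
near=> w; have w0 : 0 < w by near: w; exact: nbhs_pinfty_gt.
rewrite normfV norm_jaxis gtr0_norm // -fmorphV ltcE /= ei eqxx /=.
rewrite invf_plt ?posrE //; near: w; exact: nbhs_pinfty_gt (num_real _).
Unshelve. all: by end_near. Qed.

Lemma near_jaxis_right0 : \forall w \near (0 : R)^'+, jaxis w != 0.
Proof.
by near=> w; rewrite jaxis_eq0 gt_eqF //; near: w; exact: nbhs_right_gt.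
Unshelve. all: by end_near. Qed.

Lemma near_jaxisV_pinfty : \forall w \near (+oo : set_system R), (jaxis w)^-1 != 0.
Proof.
by near=> w; rewrite invr_eq0 jaxis_eq0 gt_eqF //; near: w; exact: nbhs_pinfty_gt.
Unshelve. all: by end_near. Qed.

Lemma cvg_reval r (T : Type) (F : set_system T) {FF : Filter F}
    (u : T -> R[i]) (a : R[i]) :
  u z @[z --> F] --> a -> rpole_order r a = 0%N ->
  reval r (u z) @[z --> F] --> reval r a.
Proof.
move=> ua /eqP; rewrite rpole_order_eq0 => ra.
exact: (@cvg_ratfun R[i] _ _ T F FF u a ua ra).
Qed.

Lemma near_rpole_order_eq0 r (T : Type) (F : set_system T) {FF : Filter F}
    (u : T -> R[i]) (a : R[i]) :
  u z @[z --> F] --> a -> rpole_order r a = 0%N ->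
  \forall z \near F, rpole_order r (u z) = 0%N.
Proof.
move=> ua /eqP; rewrite rpole_order_eq0 => ra.
apply: filterS (@near_neq R[i] T F FF _ _ (@cvg_horner R[i] _ T F FF u a ua) ra) => z.
by rewrite -rpole_order_eq0 => /eqP.
Qed.

Lemma dnbhs_rpole_order_eq0 r (a : R[i]) : \forall z \near a^', rpole_order r z = 0%N.
Proof.
have d0 : (denom r)^%:C != 0 by rewrite map_poly_eq0 denom_neq0.
apply: filterS (@dnbhs_horner_neq0 R[i] _ a d0) => z.
by rewrite -rpole_order_eq0 => /eqP.
Qed.

Section AtInfinity.
Variables (T : Type) (F : set_system T) (u : T -> R[i]).
Context {FF : ProperFilter F}.
Hypothesis u_cvg0 : (u z)^-1 @[z --> F] --> (0 : R[i]).
Hypothesis u_neq0 : \forall z \near F, (u z)^-1 != 0.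

Lemma near_infty_rpole_order_eq0 r : \forall z \near F, rpole_order r (u z) = 0%N.
Proof.
have d0 : (denom r)^%:C != 0 by rewrite map_poly_eq0 denom_neq0.
apply: filterS (@near_horner_inv_neq0 R[i] T F (fun z => (u z)^-1) FF u_cvg0 u_neq0 _ d0) => z.
by rewrite invrK -rpole_order_eq0 => /eqP.
Qed.

(** The limit is the quotient of the coefficients in the degree of the denominator; a strictly
    proper numerator has coefficient 0 there. *)
Lemma cvg_reval_infty r : rpole_order_infty r = 0%N ->
  exists2 l, reval r (u z) @[z --> F] --> l & (rstrictly_proper r -> l = 0).
Proof.
move=> /eqP; rewrite subn_eq0 => nd.
have d0 : (denom r)^%:C != 0 by rewrite map_poly_eq0 denom_neq0.
have nd' : (size (numer r)^%:C <= size (denom r)^%:C)%N by rewrite !size_map_poly.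
exists ((numer r)^%:C`_(size (denom r)^%:C).-1 / lead_coef (denom r)^%:C).
  apply: (@cvg_near_eq R[i] T F FF _ _ _ _
    (@cvg_ratfun_inv R[i] T F (fun z => (u z)^-1) FF u_cvg0 u_neq0 _ _ d0 nd')) => //.
  by apply: nearW => z; rewrite invrK.
rewrite /rstrictly_proper => lt_nd; rewrite nth_default ?mul0r // !size_map_poly.
by rewrite -ltnS prednK // size_poly_gt0 denom_neq0.
Qed.

End AtInfinity.

End ComplexLimits.

(** * Adding a matrix Laurent polynomial *)

Section MatrixLaurent.
Variables (R : realType) (n : nat).
Implicit Types (G : 'M[{fraction {poly R}}]_n).

Lemma is_poleN G (z : R[i]) : ~~ is_pole G z <-> forall i j, rpole_order (G i j) z = 0%N.
Proof.
rewrite /is_pole lt0n negbK -leqn0; split=> [/bigmax_leqP G0 i j|G0].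
  by apply/eqP; rewrite -leqn0; have /bigmax_leqP := G0 i isT; exact.
by apply/bigmax_leqP => i _; apply/bigmax_leqP => j _; rewrite G0.
Qed.

Lemma is_pole_inftyN G :
  ~~ is_pole_infty G <-> forall i j, rpole_order_infty (G i j) = 0%N.
Proof.
rewrite /is_pole_infty lt0n negbK -leqn0; split=> [/bigmax_leqP G0 i j|G0].
  by apply/eqP; rewrite -leqn0; have /bigmax_leqP := G0 i isT; exact.
by apply/bigmax_leqP => i _; apply/bigmax_leqP => j _; rewrite G0.
Qed.

Lemma psdmx0 : psdmx (0 : 'M[R[i]]_n).
Proof.
split; first by apply/is_hermitianmxP; rewrite trmx0 map_mx0 scaler0.
by move=> x; rewrite mulmx0 mul0mx mxE.
Qed.

Lemma nsdmx0 : nsdmx (0 : 'M[R[i]]_n).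
Proof. by have [h h'] := psdmx0; split=> // x; rewrite mulmx0 mul0mx mxE. Qed.

Section AddLaurent.
Variables (G G0 : 'M[{fraction {poly R}}]_n) (C1 C2 A1 A2 B : 'M[R]_n).

Definition is_laurent_shift := forall i j, G i j =
  G0 i j + rlaurent (C1 i j) (C2 i j) (A1 i j) (A2 i j) (B i j).

Hypothesis G_eq : is_laurent_shift.

Lemma is_laurent_shift_leq (z : R[i]) : z != 0 -> (pole_order G z <= pole_order G0 z)%N.
Proof.
move=> z0; apply/bigmax_leqP => i _; apply/bigmax_leqP => j _; rewrite G_eq.
apply: leq_trans (rpole_order_add_laurent_leq _ _ _ _ _ _ z0) _.
apply: leq_trans (leq_bigmax i).
exact: (leq_bigmax (F := fun j => rpole_order (G0 i j) z) j).
Qed.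

Lemma reval_shift i j (z : R[i]) : z != 0 -> rpole_order (G0 i j) z = 0%N ->
  reval (G i j) z = reval (G0 i j) z +
    laurent (C1 i j)%:C (C2 i j)%:C (A1 i j)%:C (A2 i j)%:C (B i j)%:C z.
Proof.
by move=> z0 /eqP; rewrite rpole_order_eq0 G_eq => d0; rewrite reval_add_laurent.
Qed.

Lemma cvg_residue_shift (a : R[i]) (K : 'M[R[i]]_n) : a != 0 ->
  (z - a) *: ('i *: meval G0 z) @[z --> a^'] --> K ->
  (z - a) *: ('i *: meval G z) @[z --> a^'] --> K.
Proof.
move=> a0 /(@cvg_mxP R[i]) G0K; apply/(@cvg_mxP R[i]) => i j.
have Fa : ProperFilter (a^') by exact: Proper_dnbhs_numFieldType.
apply: (@cvg_near_eq R[i] _ _ _ _ _ _ _ (@cvg_residue_laurent R[i]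
  (C1 i j)%:C (C2 i j)%:C (A1 i j)%:C (A2 i j)%:C (B i j)%:C a 'i (K i j)
  (reval (G0 i j)) (reval (G i j)) a0 _ _)) => //.
- near=> z; apply: reval_shift; near: z; last exact: dnbhs_rpole_order_eq0.
  have := @dnbhs_horner_neq0 R[i] 'X a; rewrite polyX_eq0 => /(_ isT).
  by apply: filterS => z; rewrite hornerX.
- apply: (@cvg_near_eq R[i] _ _ _ _ _ _ _ (G0K i j)) => //.
  by apply: nearW => z; rewrite !mxE.
- by apply: nearW => z; rewrite !mxE.
Unshelve. all: by end_near. Qed.

End AddLaurent.

(** The relation is symmetric up to sign, so a one-sided statement about [G] and [G0] can be used in
    both directions. *)
Lemma is_laurent_shiftC G G0 C1 C2 A1 A2 B :
  is_laurent_shift G G0 C1 C2 A1 A2 B ->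
  is_laurent_shift G0 G (- C1) (- C2) (- A1) (- A2) (- B).
Proof.
move=> G_eq i j; rewrite G_eq !mxE /rlaurent /rconst !polyCN !tofracN laurentN.
by rewrite addrK.
Qed.

Lemma pole_order_shift G G0 C1 C2 A1 A2 B (z : R[i]) :
  is_laurent_shift G G0 C1 C2 A1 A2 B -> z != 0 -> pole_order G z = pole_order G0 z.
Proof.
move=> G_eq z0; apply/eqP; rewrite eqn_leq (is_laurent_shift_leq G_eq z0).
exact: (is_laurent_shift_leq (is_laurent_shiftC G_eq) z0).
Qed.

(** * Shifts of a strictly proper matrix that is regular at 0 *)

Section RegularPart.
Variables (G G0 : 'M[{fraction {poly R}}]_n) (C1 C2 A1 A2 B : 'M[R]_n).
Hypothesis G_eq : is_laurent_shift G G0 C1 C2 A1 A2 B.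
Hypothesis G0_reg0 : forall i j, rpole_order (G0 i j) 0%R = 0%N.
Hypothesis G0_sp : strictly_proper G0.

Let G0_reg_infty i j : rpole_order_infty (G0 i j) = 0%N.
Proof. by apply/eqP; rewrite subn_eq0; apply: ltnW; exact: G0_sp. Qed.

Lemma pole_order_shift0 : (pole_order G 0%R <= 2)%N.
Proof.
apply/bigmax_leqP => i _; apply/bigmax_leqP => j _; rewrite G_eq.
exact: rpole_order_add_laurent_at0.
Qed.

Lemma pole_order_shift_infty : (pole_order_infty G <= 2)%N.
Proof.
apply/bigmax_leqP => i _; apply/bigmax_leqP => j _; rewrite G_eq.
exact: rpole_order_infty_add_laurent.
Qed.

Let F0 : ProperFilter ((0 : R[i])^').
Proof. exact: Proper_dnbhs_numFieldType. Qed.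

Let id_cvg0 : z @[z --> (0 : R[i])^'] --> (0 : R[i]).
Proof. exact: cvg_within. Qed.

Let near0_neq0 : \forall z \near (0 : R[i])^', z != 0.
Proof. exact: nbhs_dnbhs_neq. Qed.

Let near0_reval i j : \forall z \near (0 : R[i])^', reval (G i j) z =
  reval (G0 i j) z +
  laurent (C1 i j)%:C (C2 i j)%:C (A1 i j)%:C (A2 i j)%:C (B i j)%:C z.
Proof.
near=> z; apply: (reval_shift G_eq); first by near: z.
near: z; exact: dnbhs_rpole_order_eq0.
Unshelve. all: by end_near. Qed.

Let cvg0_G0 i j := @cvg_reval R (G0 i j) _ _ _ _ _ id_cvg0 (G0_reg0 i j).

Lemma cvg_shift0 : z ^+ 2 *: meval G z @[z --> (0 : R[i])^'] --> complexmx C2.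
Proof.
apply/(@cvg_mxP R[i]) => i j.
apply: (@cvg_near_eq R[i] _ _ _ _ _ _ _ (@cvg_laurent_mul2 R[i] _ _ _ F0
  id_cvg0 near0_neq0 _ _ (@cvg0_G0 i j) (C1 i j)%:C (C2 i j)%:C
  (A1 i j)%:C (A2 i j)%:C (B i j)%:C)).
  by rewrite mxE.
by apply: filterS (near0_reval i j) => z e; rewrite !mxE e.
Qed.

Lemma cvg_shift0_high m : (3 <= m)%N ->
  z ^+ m *: meval G z @[z --> (0 : R[i])^'] --> (0 : 'M[R[i]]_n).
Proof.
move=> m3; apply/(@cvg_mxP R[i]) => i j.
apply: (@cvg_near_eq R[i] _ _ _ _ _ _ _ (@cvg_laurent_mul R[i] _ _ _ F0
  id_cvg0 near0_neq0 _ _ (@cvg0_G0 i j) m (C1 i j)%:C (C2 i j)%:C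
  (A1 i j)%:C (A2 i j)%:C (B i j)%:C m3)).
  by rewrite mxE.
by apply: filterS (near0_reval i j) => z e; rewrite !mxE e.
Qed.

(** For [G] regular at 0 the limit [C2] of z^2 G(z) must be 0. This settles the case where the
    condition on a pole at 0 is vacuous. *)
Lemma shift_no_pole0 : ~~ is_pole G 0 -> C2 = 0.
Proof.
move=> /is_poleN G_reg0; apply/matrixP => i j; rewrite mxE.
have /(@cvg_mxP R[i]) /(_ i j) lim_C2 := cvg_shift0.
have Gij := @cvg_reval R (G i j) _ _ F0 _ _ id_cvg0 (G_reg0 i j).
apply: (fmorph_inj (real_complex R)); rewrite rmorph0.
have lim0 := @cvg_sqr_mul0 R[i] _ _ _ F0 id_cvg0 _ _ Gij.
rewrite mxE in lim_C2; apply: (@limit_unique R[i] _ _ F0 _ _ _ lim_C2).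
by apply: (@cvg_near_eq R[i] _ _ F0 _ _ _ _ lim0) => //; apply: nearW => z; rewrite !mxE.
Qed.

Let Foo : ProperFilter (+oo : set_system R).
Proof. exact: proper_pinfty_nbhs. Qed.

Let u_cvg0 := @cvg_jaxisV_pinfty R.
Let u_neq0 := @near_jaxisV_pinfty R.

Let cvg_infty_G0 i j : reval (G0 i j) (jaxis w) @[w --> +oo] --> (0 : R[i]).
Proof.
have [l lim_l l0] := @cvg_reval_infty R _ _ _ Foo u_cvg0 u_neq0 _ (G0_reg_infty i j).
by rewrite (l0 (G0_sp i j)) in lim_l.
Qed.

(** Written in 1/(jw), with coefficients exchanged by [laurentV], so that the limits at 0 apply. *)
Let near_infty_reval i j : \forall w \near (+oo : set_system R),
  reval (G i j) (jaxis w) = reval (G0 i j) (jaxis w) +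
  laurent (A1 i j)%:C (A2 i j)%:C (C1 i j)%:C (C2 i j)%:C (B i j)%:C (jaxis w)^-1.
Proof.
near=> w; rewrite laurentV; apply: (reval_shift G_eq).
  by rewrite -invr_eq0; near: w; exact: u_neq0.
near: w; exact: near_infty_rpole_order_eq0.
Unshelve. all: by end_near. Qed.

Lemma cvg_shift_infty :
  (jaxis w ^+ 2)^-1 *: meval G (jaxis w) @[w --> +oo] --> complexmx A2.
Proof.
apply/(@cvg_mxP R[i]) => i j.
apply: (@cvg_near_eq R[i] _ _ _ _ _ _ _ (@cvg_laurent_mul2 R[i] _ _ _ Foo
  u_cvg0 u_neq0 _ _ (@cvg_infty_G0 i j) (A1 i j)%:C (A2 i j)%:C
  (C1 i j)%:C (C2 i j)%:C (B i j)%:C)).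
  by rewrite mxE.
by apply: filterS (near_infty_reval i j) => w e; rewrite !mxE e exprVn.
Qed.

Lemma cvg_shift_infty_high m : (3 <= m)%N ->
  (jaxis w ^+ m)^-1 *: meval G (jaxis w) @[w --> +oo] --> (0 : 'M[R[i]]_n).
Proof.
move=> m3; apply/(@cvg_mxP R[i]) => i j.
apply: (@cvg_near_eq R[i] _ _ _ _ _ _ _ (@cvg_laurent_mul R[i] _ _ _ Foo
  u_cvg0 u_neq0 _ _ (@cvg_infty_G0 i j) m (A1 i j)%:C (A2 i j)%:C
  (C1 i j)%:C (C2 i j)%:C (B i j)%:C m3)).
  by rewrite mxE.
by apply: filterS (near_infty_reval i j) => w e; rewrite !mxE e exprVn.
Qed.

Lemma shift_no_pole_infty : ~~ is_pole_infty G -> A2 = 0.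
Proof.
move=> /is_pole_inftyN G_reg; apply/matrixP => i j; rewrite mxE.
have /(@cvg_mxP R[i]) /(_ i j) lim_A2 := cvg_shift_infty.
have [l Gij _] := @cvg_reval_infty R _ _ _ Foo u_cvg0 u_neq0 _ (G_reg i j).
apply: (fmorph_inj (real_complex R)); rewrite rmorph0.
have lim0 := @cvg_sqr_mul0 R[i] _ _ _ Foo u_cvg0 _ _ Gij.
rewrite mxE in lim_A2; apply: (@limit_unique R[i] _ _ Foo _ _ _ lim_A2).
apply: (@cvg_near_eq R[i] _ _ Foo _ _ _ _ lim0) => //.
by apply: nearW => w; rewrite !mxE exprVn.
Qed.

Definition symmetric_shift := [/\ A2 = A2^T, C2 = C2^T, A1 + A1^T = 0,
  C1 + C1^T = 0 & B = B^T].

(** Conjugation sends jw to -jw, so transposed coefficients are added for odd powers and subtracted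
    for even ones. *)
Let jdiff_laurent (w : R) i j : R[i] :=
  laurent (C1 i j + C1 j i)%:C (C2 i j - C2 j i)%:C
    (A1 i j + A1 j i)%:C (A2 i j - A2 j i)%:C (B i j - B j i)%:C (jaxis w).

Let jdiff_shift (w : R) i j : 0 < w -> ~~ is_pole G0 (jaxis w) ->
  jdiff G w i j = 'i * (reval (G0 i j) (jaxis w) - Num.conj (reval (G0 j i) (jaxis w))
                        + jdiff_laurent w i j).
Proof.
move=> w0 /is_poleN G0_reg.
have u0 : jaxis w != 0 by rewrite jaxis_eq0 gt_eqF.
have conjG : Num.conj (reval (G j i) (jaxis w)) = Num.conj (reval (G0 j i) (jaxis w)) +
    laurent (C1 j i)%:C (C2 j i)%:C (A1 j i)%:C (A2 j i)%:C (B j i)%:C (- jaxis w).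
  rewrite (reval_shift G_eq) // rmorphD; congr (_ + _).
  rewrite rmorph_laurent; congr laurent; [exact: conj_real.. | exact: conj_jaxis].
rewrite !mxE conjG (reval_shift G_eq) //.
congr (_ * _); rewrite /jdiff_laurent /laurent !(rmorphD, rmorphB) /=.
by field.
Qed.

Lemma jdiff_symmetric_shift (w : R) : symmetric_shift -> 0 < w ->
  ~~ is_pole G0 (jaxis w) -> jdiff G w = jdiff G0 w.
Proof.
move=> [A2s C2s A1s C1s Bs] w0 G0_reg; apply/matrixP => i j.
rewrite jdiff_shift // /jdiff_laurent /laurent.
have entry (M : 'M[R]_n) : M + M^T = 0 -> M i j + M j i = 0.
  by move/matrixP/(_ i j); rewrite !mxE.
have entry' (M : 'M[R]_n) : M = M^T -> M i j - M j i = 0.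
  by move/matrixP/(_ i j); rewrite !mxE => ->; rewrite subrr.
rewrite (entry _ A1s) (entry _ C1s) !entry' // !mulr0 !addr0.
by rewrite !mxE.
Qed.

Lemma lossless_symmetric_shift :
  (forall w : R, 0 < w -> ~~ is_pole G (jaxis w) -> jdiff G w = 0) ->
  symmetric_shift.
Proof.
move=> G_lossless.
(* On w > 0 the poles of [G] are those of [G0]; cancelling the factor 'i leaves a scalar equation
   for each entry. *)
have diff0 (w : R) i j : 0 < w -> ~~ is_pole G0 (jaxis w) ->
    reval (G0 i j) (jaxis w) - Num.conj (reval (G0 j i) (jaxis w)) + jdiff_laurent w i j = 0.
  move=> w0 G0_reg; have u0 : jaxis w != 0 by rewrite jaxis_eq0 gt_eqF.
  apply: (mulfI (neq0Ci R[i])); rewrite mulr0 -jdiff_shift //.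
  by rewrite G_lossless ?mxE // /is_pole (pole_order_shift G_eq u0).
have F0r : ProperFilter ((0 : R)^'+) by exact: at_right_proper_filter.
have real0 (x : R) : x%:C = 0 :> R[i] -> x = 0.
  by move=> x0; apply: (fmorph_inj (real_complex R)); rewrite rmorph0.
have near0_reg : \forall w \near (0 : R)^'+, ~~ is_pole G0 (jaxis w).
  have reg i := @filter_forall _ _
    (fun j w => rpole_order (G0 i j) (jaxis w) = 0%N) _ F0r
    (fun j => @near_rpole_order_eq0 R (G0 i j) _ _ F0r _ _ (@cvg_jaxis_right0 R) (G0_reg0 i j)).
  have := @filter_forall _ _
    (fun i w => forall j, rpole_order (G0 i j) (jaxis w) = 0%N) _ F0r reg.
  by apply: filterS => w G0_reg; apply/is_poleN.
have nearoo_reg : \forall w \near (+oo : set_system R), ~~ is_pole G0 (jaxis w).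
  have reg i := @filter_forall _ _
    (fun j w => rpole_order (G0 i j) (jaxis w) = 0%N) _ Foo
    (fun j => @near_infty_rpole_order_eq0 R _ _ _ Foo u_cvg0 u_neq0 (G0 i j)).
  have := @filter_forall _ _
    (fun i w => forall j, rpole_order (G0 i j) (jaxis w) = 0%N) _ Foo reg.
  by apply: filterS => w G0_reg; apply/is_poleN.
(* At 0 the equation for [B] still contains the limit of the [G0] part; only the [C] coefficients
   are read here. *)
have sym0 i j : C1 i j + C1 j i = 0 /\ C2 i j - C2 j i = 0.
  have lim i' j' := @cvg_reval R (G0 i' j') _ _ F0r _ _ (@cvg_jaxis_right0 R) (G0_reg0 i' j').
  have [] := @laurent_coef_eq0 R[i] _ _ _ F0r (@cvg_jaxis_right0 R) (@near_jaxis_right0 R) _ _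
    (@cvg_sub_conj R[i] _ _ F0r _ _ _ _ (@lim i j) (@lim j i))
    (C1 i j + C1 j i)%:C (C2 i j - C2 j i)%:C
    (A1 i j + A1 j i)%:C (A2 i j - A2 j i)%:C (B i j - B j i)%:C.
    near=> w; apply: diff0; first by near: w; exact: nbhs_right_gt.
    by near: w.
  by move=> /real0 ? /real0.
have symoo i j : [/\ A1 i j + A1 j i = 0, A2 i j - A2 j i = 0 & B i j - B j i = 0].
  have [] := @laurent_coef_eq0 R[i] _ _ _ Foo u_cvg0 u_neq0 _ _
    (@cvg_sub_conj R[i] _ _ Foo _ _ _ _ (@cvg_infty_G0 i j) (@cvg_infty_G0 j i))
    (A1 i j + A1 j i)%:C (A2 i j - A2 j i)%:C
    (C1 i j + C1 j i)%:C (C2 i j - C2 j i)%:C (B i j - B j i)%:C.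
    near=> w; rewrite laurentV; apply: diff0; first by near: w; exact: nbhs_pinfty_gt.
    by near: w.
  (* Here the [G0] part tends to 0, so the third equation is about [B] alone. *)
  by rewrite conjC0 subrr add0r => /real0 ? /real0 ? /real0.
by split; apply/matrixP => i j; rewrite !mxE; have [? ?] := sym0 i j;
  have [? ? ?] := symoo i j => //; apply/eqP; rewrite -subr_eq0; apply/eqP.
Unshelve. all: by end_near. Qed.

End RegularPart.

End MatrixLaurent.

Theorem lemma6 (R : realType) (n : nat)
  (G G0 : 'M[{fraction {poly R}}]_n) (C1 C2 A1 A2 Ginf : 'M[R]_n)
  (hG : G = G0 + rvar^-1 *: ratmx C1 + (rvar ^+ 2)^-1 *: ratmx C2
            + rvar *: ratmx A1 + rvar ^+ 2 *: ratmx A2 + ratmx Ginf)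
  (hG0sp : strictly_proper G0)
  (hG0zero : ~~ is_pole G0 0)
  (hG0infty : ~~ is_pole_infty G0) :
  lossless_negative_imaginary G <->
  lossless_negative_imaginary G0 /\
  (complexmx A2 = (complexmx A2) ^t* /\ nsdmx (complexmx A2)) /\
  (complexmx C2 = (complexmx C2) ^t* /\ psdmx (complexmx C2)) /\
  complexmx A1 + (complexmx A1) ^t* = 0 /\
  complexmx C1 + (complexmx C1) ^t* = 0 /\
  Ginf = Ginf^T.
Proof.
have G_eq : is_laurent_shift G G0 C1 C2 A1 A2 Ginf.
  by move=> i j; rewrite hG !mxE /rlaurent /laurent !addrA.
have G0_reg0 := (is_poleN _ _).1 hG0zero.
(* The entries are real: the adjoint is the transpose, and all conditions on coefficients descend to
   [R]. *)
have adj (M : 'M[R]_n) : (complexmx M) ^t* = complexmx M^T.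
  by apply/matrixP => i j; rewrite !mxE; exact: conj_real.
have cD (M N : 'M[R]_n) : complexmx M + complexmx N = complexmx (M + N).
  by rewrite -map_mxD.
have c0 : complexmx 0 = 0 :> 'M[R[i]]_n by exact: map_mx0.
have cI (M N : 'M[R]_n) : complexmx M = complexmx N -> M = N.
  move/matrixP => MN; apply/matrixP => i j.
  by have := MN i j; rewrite !mxE => /(fmorph_inj (real_complex R)).
have jaxis0 (w : R) : 0 < w -> jaxis w != 0 by move=> w0; rewrite jaxis_eq0 gt_eqF.
have pole (z : R[i]) : z != 0 -> is_pole G z = is_pole G0 z.
  by move=> z0; rewrite /is_pole (pole_order_shift G_eq z0).
have Re0 (z : R[i]) : 0 < complex.Re z -> z != 0.
  by apply: contraTneq => ->; rewrite ltxx.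
have F0 : ProperFilter ((0 : R[i])^') by exact: Proper_dnbhs_numFieldType.
have Foo : ProperFilter (+oo : set_system R) by exact: proper_pinfty_nbhs.
rewrite !adj !cD; split=> [[G_ni G_lossless]|].
  have sym := lossless_symmetric_shift G_eq G0_reg0 hG0sp G_lossless.
  have G0_lossless (w : R) : 0 < w -> ~~ is_pole G0 (jaxis w) -> jdiff G0 w = 0.
    move=> w0 G0w; rewrite -(jdiff_symmetric_shift G_eq sym w0 G0w).
    by rewrite G_lossless // pole // jaxis0.
  have [A2s C2s A1s C1s Bs] := sym.
  split; first (split; last exact: G0_lossless); first split.
  - by move=> z z0; rewrite -pole ?Re0 // (ni_stable G_ni).
  (* Losslessness makes the matrix 0, hence semidefinite. *)
  - by move=> w w0 G0w; rewrite G0_lossless //; exact: psdmx0.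
  - by rewrite (negbTE hG0zero).
  - move=> w0 w0_gt; rewrite -pole ?jaxis0 // => Gw.
    have [order_le [K K_lim K_psd]] := ni_pole_axis G_ni w0_gt Gw.
    split; first by rewrite -(pole_order_shift G_eq) ?jaxis0.
    exists K; last exact: K_psd.
    (* The reversed shift carries the residue from [G] back to [G0]. *)
    exact: (cvg_residue_shift (is_laurent_shiftC G_eq) (jaxis0 _ w0_gt) K_lim).
  - by rewrite (negbTE hG0infty).
  split; [split|split; [split|split; [|split]]].
  - by rewrite -A2s.
  (* At a pole, the semidefinite limit is [A2] by uniqueness; otherwise [A2] is 0. The same
     dichotomy at 0 handles [C2]. *)
  - have [G_pole|/(shift_no_pole_infty G_eq hG0sp) ->] := boolP (is_pole_infty G); last first.
      by rewrite c0; exact: nsdmx0.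
    have [_ [K K_lim K_nsd] _] := ni_pole_infty G_ni G_pole.
    by rewrite (@limit_mx_unique R[i] _ _ Foo _ _ _ _ (cvg_shift_infty G_eq hG0sp) K_lim).
  - by rewrite -C2s.
  - have [G_pole|/(shift_no_pole0 G_eq G0_reg0) ->] := boolP (is_pole G 0); last first.
      by rewrite c0; exact: psdmx0.
    have [_ [K K_lim K_psd] _] := ni_pole0 G_ni G_pole.
    by rewrite (@limit_mx_unique R[i] _ _ F0 _ _ _ _ (cvg_shift0 G_eq G0_reg0) K_lim).
  - by rewrite A1s c0.
  - by rewrite C1s c0.
  - exact: Bs.
move=> [[G0_ni G0_lossless] [[/cI A2s A2_nsd] [[/cI C2s C2_psd] [A1s [C1s Bs]]]]].
have sym : symmetric_shift C1 C2 A1 A2 Ginf.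
  by split=> //; apply: cI; rewrite c0.
have G_lossless (w : R) : 0 < w -> ~~ is_pole G (jaxis w) -> jdiff G w = 0.
  move=> w0; rewrite pole ?jaxis0 // => G0w.
  by rewrite (jdiff_symmetric_shift G_eq sym w0 G0w) G0_lossless.
split; last exact: G_lossless.
split.
- by move=> z z0; rewrite (pole _ (Re0 _ z0)); exact: (ni_stable G0_ni z0).
- move=> w w0 Gw; rewrite (G_lossless w w0 Gw); exact: psdmx0.
(* The required limit is [C2], semidefinite by assumption; at infinity it is [A2]. *)
- move=> _; split; first exact: pole_order_shift0 G_eq G0_reg0.
    exists (complexmx C2); last exact: C2_psd.
    exact: cvg_shift0 G_eq G0_reg0.
  move=> m m3; refine (cvg_shift0_high G_eq G0_reg0 m3).
- move=> w0 w0_gt; rewrite pole ?jaxis0 // => G0w.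
  have [order_le [K K_lim K_psd]] := ni_pole_axis G0_ni w0_gt G0w.
  split; first by rewrite (pole_order_shift G_eq) ?jaxis0.
  exists K; last exact: K_psd.
  exact: (cvg_residue_shift G_eq (jaxis0 _ w0_gt) K_lim).
- move=> _; split; first exact: pole_order_shift_infty G_eq hG0sp.
    exists (complexmx A2); last exact: A2_nsd.
    exact: cvg_shift_infty G_eq hG0sp.
  move=> m m3; refine (cvg_shift_infty_high G_eq hG0sp m3).
Qed.
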